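(* Let $n \ge 2$ and let $L$ be a finite-dimensional $2$-soluble $n$-Lie algebra over a field $F$, and let $A$ be a minimal abelian embedded ideal of $L$. Suppose that $\mathcal{C}_L(A) = A$. Then $L$ splits over $A$ (that is, $A$ has a complement in $L$), and all complements to $A$ in $L$ are $A$-conjugate.
   Context: An $n$-Lie algebra over a field $F$ is an $F$-vector space $L$ with a linear map $\Lambda^n L \to L$, $x_1\wedge\dots\wedge x_n \mapsto [x_1,\dots,x_n]$ (so the bracket is $n$-linear and alternating), satisfying the generalised Jacobi identity $$[[x_1,\dots,x_n],y_2,\dots,y_n]=\sum_{i=1}^n [x_1,\dots,[x_i,y_2,\dots,y_n],\dots,x_n].$$ For subspaces $A_1,\dots,A_n$ of $L$, $[A_1,\dots,A_n]$ denotes the span of all $[a_1,\dots,a_n]$ with $a_i\in A_i$; $[r_1A_1,\dots,r_pA_p]$ means that $A_i$ is repeated $r_i$ times, $\sum r_i=n$, and $r_i$ is omitted when it is $1$. A subspace $K$ is a subalgebra if $[nK]\subseteq K$ and an ideal if $[K,(n-1)L]\subseteq K$. $L$ is $2$-soluble if $L^{(r,2)}=0$ for some $r$, where $L^{(0,2)}=L$ and $L^{(s+1,2)}=[2L^{(s,2)},(n-2)L]$. An ideal $A$ of $L$ is abelian embedded in $L$ if $[2A,(n-2)L]=0$. A minimal abelian embedded ideal is a minimal (nonzero) ideal of $L$ which is abelian embedded in $L$. The centraliser of an ideal $A$ is $\mathcal{C}_L(A)=\{c\in L\mid [c,A,(n-2)L]=0\}$, i.e. $[c,a,x_1,\dots,x_{n-2}]=0$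 for all $a\in A$, $x_i\in L$. A complement to $A$ in $L$ is a subalgebra $U$ of $L$ with $U+A=L$ and $U\cap A=0$. For $a_1,\dots,a_{n-1}\in L$, $D(a_1,\dots,a_{n-1}):L\to L$ is the map $x\mapsto[a_1,\dots,a_{n-1},x]$. If $A$ is an abelian embedded ideal, then for $a\in A$ and $x_1,\dots,x_{n-2}\in L$ the map $1+D(a,x_1,\dots,x_{n-2})$ is an automorphism of $L$; such automorphisms, and any products of them, are called $A$-inner automorphisms. Subalgebras $U,V$ of $L$ are $A$-conjugate if $\alpha U=V$ for some $A$-inner automorphism $\alpha$. *)

(* Defs.v *)
From mathcomp Require Import all_boot all_order all_algebra.
From mathcomp Require Import boolp classical_sets.

Set Implicit Arguments.
Unset Strict Implicit.
Unset Printing Implicit Defensive.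

Import GRing.Theory.
Local Open Scope classical_set_scope.
Local Open Scope ring_scope.

Definition tset (n : nat) (T : Type) (x : n.-tuple T) (i : 'I_n) (u : T) :
    n.-tuple T :=
  [tuple if j == i then u else tnth x j | j < n].

(* The arity is [n = m.+2], so that [m] ranges over all naturals exactly when
   [n >= 2].  Finite dimension is part of [vectType]. *)
Record nLie (m : nat) (F : fieldType) (L : vectType F) := NLie {
  bracket :> m.+2.-tuple L -> L;
  bracket_linear : forall (x : m.+2.-tuple L) (i : 'I_m.+2) (a : F) (u v : L),
    bracket (tset x i (a *: u + v))
      = a *: bracket (tset x i u) + bracket (tset x i v);
  bracket_alternating : forall (x : m.+2.-tuple L) (i j : 'I_m.+2),
    i != j -> tnth x i = tnth x j -> bracket x = 0;
  bracket_jacobi : forall (x : m.+2.-tuple L) (y : m.+1.-tuple L),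
    bracket [tuple of bracket x :: y]
      = \sum_(i < m.+2) bracket (tset x i (bracket [tuple of tnth x i :: y]))
}.

Section Notions.

Variables (m : nat) (F : fieldType) (L : vectType F) (br : nLie m L).
Implicit Types (S : set L) (A K U V : {vspace L}).

Definition span_set S : set L :=
  [set v | exists2 s : seq L, (forall u, u \in s -> S u) & v \in <<s>>%VS].

(* [A_1, ..., A_n] *)
Definition bracket_sets (A : 'I_m.+2 -> set L) : set L :=
  span_set [set br x | x in [set x | forall i, A i (tnth x i)]].

(* [r S, (n - r) L] *)
Definition bracket_rep (r : nat) S : set L :=
  bracket_sets (fun i => if (i < r)%N then S else setT).

Definition is_subalgebra K := bracket_rep m.+2 [set` K] `<=` [set` K].

Definition is_ideal K := bracket_rep 1 [set` K] `<=` [set` K].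

Fixpoint derived2 (s : nat) : set L :=
  if s is s'.+1 then bracket_rep 2 (derived2 s') else setT.

Definition soluble2 := exists r : nat, derived2 r = [set 0].

Definition abelian_embedded A := bracket_rep 2 [set` A] = [set 0].

Definition minimal_ideal A :=
  [/\ is_ideal A, A <> 0%VS &
      forall B : {vspace L}, is_ideal B -> B <> 0%VS -> (B <= A)%VS -> B = A].

Definition minimal_abelian_embedded_ideal A :=
  minimal_ideal A /\ abelian_embedded A.

Definition centraliser A : set L :=
  [set c | forall (a : L) (x : m.-tuple L), a \in A ->
     br [tuple of c :: a :: x] = 0].

Definition is_complement A U :=
  [/\ is_subalgebra U, (U + A)%VS = fullv & (U :&: A)%VS = 0%VS].

Definition adD (a : m.+1.-tuple L) (x : L) : L := br [tuple of rcons a x].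

(* The identity is included, as the generator with [a = 0]; for abelian
   embedded [A] each generator is an automorphism, with inverse given by
   [- a]. *)
Inductive inner_automorphism A : (L -> L) -> Prop :=
| InnerGen (a : L) (x : m.-tuple L) : a \in A ->
    inner_automorphism A (fun y => y + adD [tuple of a :: x] y)
| InnerComp (f g : L -> L) :
    inner_automorphism A f -> inner_automorphism A g ->
    inner_automorphism A (f \o g).

Definition conjugate A U V :=
  exists2 f : L -> L, inner_automorphism A f & f @` [set` U] = [set` V].

End Notions.

(* Main.v *)
(** Let [B] be the last term of the 2-derived series not contained in [A] (if
    there is none, [A = L] and all is trivial), so [[2B, (n-2)L]] lies in [A].
    Call a right multiplication [R y : u |-> [u, y_1, ..., y_(n-1)]] a [B]-hit
    if some [y_i] is in [B].  On the irreducible module [A], the operators with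
    two entries in [B] commute with every right multiplication.  If one of them
    is nonzero on [A], it is injective there by Schur.  Otherwise the [B]-hits
    commute on [A], so the Fitting null component of each of them is invariant,
    hence [0] or [A]; if it were always [A], they would all kill [A], against
    [C_L(A) = A].  So some derivation [d = R y] is injective on [A] and satisfies
    [d^2 L <= A].  Then its Fitting null component [ker d^2] is a complement.

    For complements [U] and [V], moving the entries of [y] modulo [A] into [U]
    (resp. [V]) gives [d_U] and [d_V] with [U = ker d_U^2] and [V = ker d_V^2],
    and [d_U - d_V] is in the space [I] spanned by the [R z] with an entry in
    [A].  Maps in [I] send [L] to [A] and [A] to [0], so the commutator with
    [d_U] is injective on [I], hence surjective.  If [f] in [I] satisfies
    [[d_U, f] = d_U - d_V], then [1 + f] is inner and intertwines [d_U] and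
    [d_V], so it maps [U] onto [V]. *)
From HB Require Import structures.
From mathcomp Require Import all_boot all_order all_algebra all_fingroup.
From mathcomp Require Import boolp classical_sets.
Require Import Defs.

Set Implicit Arguments.
Unset Strict Implicit.
Unset Printing Implicit Defensive.

Import GRing.Theory.
Local Open Scope classical_set_scope.
Local Open Scope ring_scope.

(** * Spans of sets as finite-dimensional subspaces *)

Section Span.

Variables (F : fieldType) (V : vectType F).

Lemma span_ind (P : V -> Prop) (s : seq V) :
    P 0 -> (forall a u v, u \in s -> P v -> P (a *: u + v)) ->
  forall v, v \in <<s>>%VS -> P v.
Proof.
move=> P0; elim: s => [|w s IHs] PD v; first by rewrite span_nil memv0 => /eqP->.
rewrite span_cons => /memv_addP[_ /vlineP[a ->] [v' sv' ->]].
apply: (PD); first exact: mem_head.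
by apply: IHs sv' => b u u' su; apply: PD; rewrite inE su orbT.
Qed.

(** Among the finite families in [S], one whose span has maximal dimension already spans everything,
    since adjoining a further element cannot enlarge it. *)
Lemma span_set_vspace (S : set V) : exists W : {vspace V}, span_set S = [set` W].
Proof.
pose P k := `[< exists2 s : seq V, (forall u, u \in s -> S u) & \dim <<s>> = k >].
have exP : exists k, P k.
  by exists 0%N; apply/asboolP; exists [::]; rewrite // span_nil dimv0.
have ubP k : P k -> (k <= dim V)%N.
  by case/asboolP=> s _ <-; rewrite -dimvf dimvS // subvf.
case: (ex_maxnP exP ubP) => k /asboolP[s sS dims] maxk.
exists <<s>>%VS; apply/seteqP; split=> v /=; last by exists s.
case=> t tS; apply/subvP/span_subvP=> {}v tv.
suff /eqP-> : (<<s>> == <<v :: s>>)%VS by rewrite memv_span // mem_head.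
rewrite eqEdim span_cons addvSr /= -span_cons dims; apply: maxk; apply/asboolP.
by exists (v :: s) => // u; rewrite inE => /predU1P[->|/sS//]; apply: tS.
Qed.

Lemma linear_set_vspace (S : set V) : S 0 ->
    (forall a u v, S u -> S v -> S (a *: u + v)) ->
  exists W : {vspace V}, S = [set` W].
Proof.
move=> S0 SD; have [W defW] := span_set_vspace S; exists W; rewrite -defW.
apply/seteqP; split=> [v Sv|v [s sS]].
  by exists [:: v]; rewrite ?memv_span ?mem_head // => u; rewrite inE => /eqP->.
by apply: span_ind => // a u w su; apply: SD; apply: sS.
Qed.

End Span.

(** * Replacing one entry of a tuple *)

Section TupleSet.

Variables (n : nat) (T : Type).

Lemma tnth_tset (x : n.-tuple T) i u j :
  tnth (tset x i u) j = if j == i then u else tnth x j.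
Proof. exact: tnth_mktuple. Qed.

Lemma tset_id (x : n.-tuple T) i : tset x i (tnth x i) = x.
Proof. by apply: eq_from_tnth => k; rewrite tnth_tset; case: eqP => [->|]. Qed.

End TupleSet.

Section TupleSetCons.

Variables (n : nat) (T : Type).

Lemma tset_cons0 (y : n.-tuple T) u v :
  tset [tuple of u :: y] ord0 v = [tuple of v :: y].
Proof.
apply: eq_from_tnth => k; rewrite tnth_tset.
by case: (unliftP ord0 k) => [j ->|->]; rewrite ?tnthS ?tnth0.
Qed.

Lemma tset_consS (y : n.-tuple T) u v i :
  tset [tuple of u :: y] (lift ord0 i) v = [tuple of u :: tset y i v].
Proof.
apply: eq_from_tnth => k; rewrite tnth_tset.
case: (unliftP ord0 k) => [j ->|->]; last by rewrite !tnth0.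
by rewrite !tnthS tnth_tset (inj_eq lift_inj).
Qed.

End TupleSetCons.

(** * Skew symmetry, ideals and right multiplications *)

Section Bracket.

Variables (m : nat) (F : fieldType) (L : vectType F) (br : nLie m L).
Implicit Types (x : m.+2.-tuple L) (y z : m.+1.-tuple L) (K T W : {vspace L}).

Lemma bracketD x i u v :
  br (tset x i (u + v)) = br (tset x i u) + br (tset x i v).
Proof. by rewrite -[u in LHS]scale1r bracket_linear scale1r. Qed.

Lemma bracket0 x i : br (tset x i 0) = 0.
Proof. by apply: (addrI (br (tset x i 0))); rewrite -bracketD !addr0. Qed.

Lemma bracketZ x i a u : br (tset x i (a *: u)) = a *: br (tset x i u).
Proof. by rewrite -[a *: u]addr0 bracket_linear bracket0 addr0. Qed.

(** Polarisation: the bracket with [a + b] in both places [i] and [j] vanishes and expands into the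
    two transposed brackets. *)
Lemma bracket_tperm x i j : i != j ->
  br [tuple tnth x (tperm i j k) | k < m.+2] = - br x.
Proof.
move=> neq_ij; pose f u v := br (tset (tset x i u) j v).
have fuu u : f u u = 0.
  apply: (bracket_alternating br neq_ij).
  by rewrite !tnth_tset eqxx (negPf neq_ij) eqxx.
have tsetC u v : tset (tset x i u) j v = tset (tset x j v) i u.
  apply: eq_from_tnth => k; rewrite !tnth_tset.
  by case: eqP => // ->; rewrite eq_sym (negPf neq_ij).
have fDr u v w : f u (v + w) = f u v + f u w by rewrite /f bracketD.
have fDl u v w : f (v + w) u = f v u + f w u by rewrite /f !tsetC bracketD.
set a := tnth x i; set b := tnth x j.
have -> : br x = f a b.
  rewrite /f; congr (br _); apply: eq_from_tnth => k; rewrite !tnth_tset.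
  by case: eqP => [->//|_]; case: eqP => [->|].
have -> : [tuple tnth x (tperm i j k) | k < m.+2] = tset (tset x i b) j a.
  apply: eq_from_tnth => k; rewrite !tnth_tset tnth_mktuple.
  case: tpermP => [->|->|/eqP/negPf-> /eqP/negPf->] //.
    by rewrite (negPf neq_ij) eqxx.
  by rewrite eqxx.
apply/eqP; rewrite -addr_eq0 -/(f b a) addrC; apply/eqP.
by have := fuu (a + b); rewrite fDl !fDr !fuu add0r addr0.
Qed.

Lemma bracket_perm x (s : 'S_m.+2) :
  br [tuple tnth x (s k) | k < m.+2] = (-1) ^+ s *: br x.
Proof.
have [ts -> dts] := prod_tpermP s.
elim: ts dts x => [_|[i j] ts IHts /= /andP[neq_ij /IHts{}IHts]] x.
  rewrite big_nil odd_perm1 scale1r; congr (br _).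
  by apply: eq_from_tnth => k; rewrite tnth_mktuple perm1.
rewrite big_cons /= odd_mul_tperm neq_ij; set t := (\prod_(_ <- _) _)%g in IHts *.
have -> : [tuple tnth x ((tperm i j * t)%g k) | k < m.+2] =
    [tuple tnth [tuple tnth x (t k) | k < m.+2] (tperm i j k) | k < m.+2].
  by apply: eq_from_tnth => k; rewrite !tnth_mktuple permM.
by rewrite bracket_tperm // IHts signr_addb mulN1r scaleNr.
Qed.

Lemma bracket_perm_eq (x x' : m.+2.-tuple L) :
  perm_eq x x' -> exists c, br x = c *: br x'.
Proof.
case/tuple_permP=> s def_x; exists ((-1) ^+ s); rewrite -bracket_perm.
by congr (br _); apply: val_inj.
Qed.

Lemma bracket_rep_sub r (S : set L) K :
    (forall x, (forall i : 'I_m.+2, (i < r)%N -> S (tnth x i)) -> br x \in K) ->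
  bracket_rep br r S `<=` [set` K].
Proof.
move=> SK v [s sS]; apply/subvP/span_subvP=> _ /sS[x /= Sx <-]; apply: SK => i ltir.
by have := Sx i; rewrite ltir.
Qed.

Lemma mem_bracket_rep r (S : set L) x :
  (forall i : 'I_m.+2, (i < r)%N -> S (tnth x i)) -> bracket_rep br r S (br x).
Proof.
move=> Sx; exists [:: br x]; last by rewrite memv_span ?mem_head.
move=> _ /[!inE]/eqP->; exists x => // i.
by case: ifP => // /Sx.
Qed.

Lemma perm_first_two (i j : 'I_m.+2) : i != j ->
  exists s : 'S_m.+2, s ord0 = i /\ s (lift ord0 ord0) = j.
Proof.
move=> neq_ij; pose k := tperm ord0 i j.
exists (tperm (lift ord0 ord0) k * tperm ord0 i)%g.
have k0 : ord0 != k by rewrite /k -{1}(tpermR ord0 i) (inj_eq perm_inj).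
by rewrite !permM (tpermD _ (_ : k != ord0)) ?(eq_sym k) // !tpermL /k tpermK.
Qed.

Lemma bracket_ideal K x (i : 'I_m.+2) :
  is_ideal br K -> tnth x i \in K -> br x \in K.
Proof.
move=> idK Ki; pose s := tperm ord0 i.
have : br [tuple tnth x (s k) | k < m.+2] \in K.
  apply: idK; apply: mem_bracket_rep => -[[|//] k0] _ /=.
  by rewrite tnth_mktuple (_ : Ordinal k0 = ord0) ?tpermL //; apply: val_inj.
by rewrite bracket_perm rpredZsign.
Qed.

Lemma bracket_rep2 (S : set L) K x (i j : 'I_m.+2) :
    bracket_rep br 2 S `<=` [set` K] -> i != j ->
  S (tnth x i) -> S (tnth x j) -> br x \in K.
Proof.
move=> sSK /perm_first_two[s [s0 s1]] Si Sj.
have : br [tuple tnth x (s k) | k < m.+2] \in K.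
  apply: sSK; apply: mem_bracket_rep => -[[|[|//]] k0] _ /=; rewrite tnth_mktuple.
    by rewrite (_ : Ordinal k0 = ord0) ?s0 //; apply: val_inj.
  by rewrite (_ : Ordinal k0 = lift ord0 ord0) ?s1 //; apply: val_inj.
by rewrite bracket_perm rpredZsign.
Qed.

Definition rmul y (u : L) := br [tuple of u :: y].

Lemma rmul_is_linear y : linear (rmul y).
Proof.
have rmulE w : rmul y w = br (tset [tuple of 0 :: y] ord0 w) by rewrite tset_cons0.
by move=> a u v; rewrite !rmulE bracket_linear.
Qed.

HB.instance Definition _ y :=
  GRing.isLinear.Build F L L _ (rmul y) (rmul_is_linear y).

Definition R y : 'End(L) := linfun (rmul y).

Lemma RE y u : R y u = br [tuple of u :: y]. Proof. by rewrite lfunE. Qed.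

Lemma R_derivation y x :
  R y (br x) = \sum_i br (tset x i (R y (tnth x i))).
Proof.
by rewrite RE bracket_jacobi; apply: eq_bigr => i _; rewrite RE.
Qed.

(** The derivation rule for [R y] on [R z u]: the first entry gives the reordered product, the other
    entries give the correction terms. *)
Lemma R_commutator y z u :
  R y (R z u) = R z (R y u) + \sum_i R (tset z i (R y (tnth z i))) u.
Proof.
rewrite [R z u]RE R_derivation big_ord_recl tset_cons0 tnth0 -RE; congr (_ + _).
by apply: eq_bigr => i _; rewrite tset_consS tnthS [RHS]RE.
Qed.

Lemma R_linear y i a u v :
  R (tset y i (a *: u + v)) = a *: R (tset y i u) + R (tset y i v).
Proof.
apply/lfunP=> w; rewrite add_lfunE scale_lfunE !RE -!tset_consS.
exact: bracket_linear.
Qed.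

Lemma R_ideal K y u : is_ideal br K -> u \in K -> R y u \in K.
Proof.
by move=> idK Ku; rewrite RE; apply: (@bracket_ideal _ _ ord0 idK); rewrite tnth0.
Qed.

Lemma R_ideal_hit K y i u : is_ideal br K -> tnth y i \in K -> R y u \in K.
Proof.
move=> idK Ky; rewrite RE; apply: (@bracket_ideal _ _ (lift ord0 i) idK).
by rewrite tnthS.
Qed.

Lemma ideal_R K : (forall y u, u \in K -> R y u \in K) -> is_ideal br K.
Proof.
move=> RK; apply: bracket_rep_sub => x /(_ ord0 isT).
by case/tupleP: x => u y; rewrite tnth0 -RE; apply: RK.
Qed.

Lemma R_bracket2 K T y i u : bracket_rep br 2 [set` K] `<=` [set` T] ->
  tnth y i \in K -> u \in K -> R y u \in T.
Proof.
move=> abK Kyi Ku; rewrite RE.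
by apply: (bracket_rep2 abK (neq_lift ord0 i)); rewrite /= ?tnthS ?tnth0.
Qed.

Lemma R_bracket2_hit K T y i j u : bracket_rep br 2 [set` K] `<=` [set` T] ->
  i != j -> tnth y i \in K -> tnth y j \in K -> R y u \in T.
Proof.
move=> abK neq_ij Kyi Kyj; rewrite RE.
have neq_ij' : lift ord0 i != lift ord0 j by rewrite (inj_eq lift_inj).
by apply: (bracket_rep2 abK neq_ij'); rewrite /= !tnthS.
Qed.

(** A derivation sends a generating bracket to a sum of brackets whose first two entries stay in the
    previous term, an ideal by induction. *)
Lemma derived2_ideal s : exists2 K : {vspace L},
  derived2 br s = [set` K] & is_ideal br K.
Proof.
elim: s => [|s [K defK idK]].
  exists fullv; first by apply/seteqP; split=> u _ //=; rewrite memvf.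
  by apply: ideal_R => y u _; rewrite memvf.
have [W defW] := @span_set_vspace F L _ : exists W, derived2 br s.+1 = [set` W].
have WE u : u \in W <-> derived2 br s.+1 u by rewrite defW.
have KE u : u \in K <-> derived2 br s u by rewrite defK.
exists W => //; apply: ideal_R => y u /WE[t tS].
move: u; apply: span_ind => [|a v w tv RWw]; first by rewrite linear0 mem0v.
rewrite linearP memvD ?memvZ // => {w RWw}.
have [x /= Sx <-] := tS _ tv; rewrite R_derivation memv_suml // => i _.
apply/WE; apply: mem_bracket_rep => j ltj.
have:= Sx j; rewrite ltj tnth_tset => Sxj.
by case: eqP => // ji; apply/KE/R_ideal => //; apply/KE; rewrite -ji.
Qed.

End Bracket.

Section LinearMaps.

Variables (F : fieldType) (L : vectType F).

Lemma iter_lfun (f : 'End(L)) k : exists g : 'End(L), forall u, g u = iter k f u.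
Proof.
elim: k => [|k [g gE]]; first by exists \1%VF => u; rewrite id_lfunE.
by exists (f \o g)%VF => u; rewrite comp_lfunE gE.
Qed.

Lemma sub_lfunE (f g : 'End(L)) u : (f - g) u = f u - g u.
Proof. by rewrite add_lfunE opp_lfunE. Qed.

End LinearMaps.

(** * Right multiplications with entries in [B], acting on [A] *)

Section HitOperators.

Variables (m : nat) (F : fieldType) (L : vectType F) (br : nLie m L).
Variables A B : {vspace L}.
Hypotheses (idA : is_ideal br A) (idB : is_ideal br B).
Hypothesis minA : forall W : {vspace L},
  is_ideal br W -> W <> 0%VS -> (W <= A)%VS -> W = A.
Hypothesis abA : abelian_embedded br A.
Hypothesis abB : bracket_rep br 2 [set` B] `<=` [set` A].
Implicit Types (y z : m.+1.-tuple L) (K : {vspace L}).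

Local Notation R := (R br).

Lemma R_abelian y i a : tnth y i \in A -> a \in A -> R y a = 0.
Proof.
move=> Ay Aa; apply/eqP; rewrite -memv0; apply: R_bracket2 Ay Aa.
by rewrite abA => _ ->; rewrite /= mem0v.
Qed.

(** Minimality of [A] for subspaces given only as predicates, such as kernels and null
    components. *)
Lemma minimal_invariant (S : set L) : S 0 ->
    (forall a u v, S u -> S v -> S (a *: u + v)) -> S `<=` [set` A] ->
    (forall y u, S u -> S (R y u)) -> (exists2 u, S u & u != 0) ->
  [set` A] `<=` S.
Proof.
move=> S0 SD; have [W ->] := linear_set_vspace S0 SD => WA RW [u /= Wu nz_u].
rewrite (minA _ _ (introT subvP WA)) //; first exact: ideal_R.
by move=> W0; rewrite W0 memv0 (negPf nz_u) in Wu.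
Qed.

Definition hit y := exists i, tnth y i \in B.
Definition hit2 y := exists i j, [/\ i != j, tnth y i \in B & tnth y j \in B].

(** Each correction term of [R_commutator] has the entry [R y z_k], which lies in [A] because two
    entries of [y] are in [B]; so it kills [A]. *)
Lemma R_hit2_central y z a : hit2 y -> a \in A -> R y (R z a) = R z (R y a).
Proof.
move=> [i [j [neq_ij Bi Bj]]] Aa; rewrite R_commutator big1 ?addr0 // => k _.
apply: (@R_abelian _ k) => //; rewrite tnth_tset eqxx.
exact: R_bracket2_hit neq_ij Bi Bj.
Qed.

Hypothesis hit2A : forall y a, hit2 y -> a \in A -> R y a = 0.

(** The correction term at the place [j] where [z] meets [B] has an entry in [A]; any other one has
    two entries in [B] and vanishes on [A] by [hit2A]. *)
Lemma R_hit_comm y z a : hit y -> hit z -> a \in A -> R y (R z a) = R z (R y a).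
Proof.
move=> [i Bi] [j Bj] Aa; rewrite R_commutator big1 ?addr0 // => k _.
have [->|neq_kj] := eqVneq k j.
  apply: (@R_abelian _ j) => //; rewrite tnth_tset eqxx.
  exact: R_bracket2 Bi Bj.
apply: hit2A => //; exists k, j; split=> //; rewrite tnth_tset.
  by rewrite eqxx; apply: R_ideal_hit Bi.
by rewrite eq_sym (negPf neq_kj).
Qed.

Lemma hit_tset y z i : hit y -> hit (tset z i (R y (tnth z i))).
Proof.
by case=> j Bj; exists i; rewrite tnth_tset eqxx; apply: R_ideal_hit Bj.
Qed.

Lemma mem_iter_R k y a : a \in A -> iter k (R y) a \in A.
Proof. by move=> Aa; elim: k => //= k; apply: R_ideal. Qed.

Lemma iter_R_hit k y z a : hit y -> hit z -> a \in A ->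
  iter k (R y) (R z a) = R z (iter k (R y) a).
Proof.
by move=> hy hz Aa; elim: k => //= k ->; rewrite R_hit_comm // mem_iter_R.
Qed.

(* [ad (R y)] squares to zero on the operators of [L] on [A], so the Fitting
   null component of [R y] in [A] is invariant under all of them. *)
Lemma null_component_invariant k y z a : hit y -> a \in A ->
  iter k (R y) a = 0 -> iter k.+1 (R y) (R z a) = 0.
Proof.
move=> hy; elim: k a => [|k IHk] a Aa; first by move=> /= ->; rewrite !linear0.
rewrite iterSr => ya0; rewrite iterSr R_commutator.
have [g gE] := iter_lfun (R y) k.+1.
rewrite -gE linearD linear_sum /= big1 => [|i _].
  by rewrite addr0 gE IHk // R_ideal.
by rewrite gE iter_R_hit ?iterSr ?ya0 ?linear0 //; apply: hit_tset.
Qed.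

(** The Fitting null component of [R y] in [A] is invariant and contains [a0], so it is [A]. *)
Lemma hit_locally_nilpotent y a0 : hit y -> a0 \in A -> a0 != 0 -> R y a0 = 0 ->
  forall a, a \in A -> exists k, iter k (R y) a = 0.
Proof.
move=> hy Aa0 nz_a0 ya0 a Aa.
pose S := [set a | a \in A /\ exists k, iter k (R y) a = 0].
suff: [set` A] `<=` S by case/(_ a Aa).
apply: minimal_invariant => [|c u v|u []//|z u|].
- by split; [rewrite mem0v | exists 0%N].
- move=> [Au [k ku]] [Av [l lv]]; split; first by rewrite memvD ?memvZ.
  exists (k + l)%N; have [g gE] := iter_lfun (R y) (k + l).
  have iter0 j : iter j (R y) 0 = 0.
    by have [h hE] := iter_lfun (R y) j; rewrite -hE linear0.
  by rewrite -gE linearP /= !gE {1}addnC !iterD ku lv !iter0 scaler0 addr0.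
- case=> Au [k ku]; split; first exact: R_ideal.
  by exists k.+1; apply: null_component_invariant.
by exists a0 => //; split=> //; exists 1%N.
Qed.

(** Take a nonzero subspace of [A] of least dimension among those invariant under all hits. The
    kernel of a hit in it is nonzero by local nilpotency and invariant by commutation, hence the
    whole subspace. *)
Lemma hit_common_kernel : A <> 0%VS ->
    (forall y, hit y -> exists a, [/\ a \in A, a != 0 & R y a = 0]) ->
  exists2 a, a \in A /\ (forall y, hit y -> R y a = 0) & a != 0.
Proof.
move=> A0 kerA.
pose P k := `[< exists W : {vspace L}, [/\ (W <= A)%VS, W != 0%VS, \dim W = k &
  forall y u, hit y -> u \in W -> R y u \in W] >].
have exP : exists k, P k.
  exists (\dim A); apply/asboolP; exists A; split=> //; first exact/eqP.
  by move=> y u _; apply: R_ideal.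
case: (ex_minnP exP) => _ /asboolP[W [WA nzW <- RW]] minW.
have [w Ww nz_w] : exists2 w, w \in W & w != 0.
  by exists (vpick W); rewrite ?memv_pick ?vpick0.
exists w => //; split=> [|y hy]; first exact: (subvP WA).
have [a [Aa nz_a ya]] := kerA _ hy.
have [k yw] := hit_locally_nilpotent hy Aa nz_a ya (subvP WA _ Ww).
(* The last nonzero iterate of [w] under [R y] serves as [v]. *)
have [v Wv [nz_v yv]] : exists2 v, v \in W & v != 0 /\ R y v = 0.
  elim: k w Ww nz_w yw => [|k IHk] w Ww nz_w.
    by move/eqP; rewrite (negPf nz_w).
  have [yw _|nz_yw] := eqVneq (R y w) 0; first by exists w.
  by rewrite iterSr; apply: IHk => //; apply: RW.
pose W' := (W :&: lker (R y))%VS.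
suff /subvP/(_ w Ww) : (W <= W')%VS by rewrite memv_cap memv_ker => /andP[_ /eqP].
rewrite -(eqP (_ : W' == W)%VS) // eqEdim capvSl /=; apply: minW; apply/asboolP.
exists W'; split=> // [||z u hz].
- exact: subv_trans (capvSl _ _) WA.
- by apply: contraNneq nz_v => W'0; rewrite -memv0 -W'0 memv_cap Wv memv_ker yv eqxx.
rewrite !memv_cap !memv_ker => /andP[Wu /eqP yu].
by rewrite RW // R_hit_comm ?yu ?linear0 ?eqxx // (subvP WA).
Qed.

(** The common kernel of the hits in [A] is an ideal, because the correction terms of a hit are hits
    again; being nonzero, it is [A]. *)
Lemma hit_centralises : A <> 0%VS ->
    (forall y, hit y -> exists a, [/\ a \in A, a != 0 & R y a = 0]) ->
  forall y a, hit y -> a \in A -> R y a = 0.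
Proof.
move=> A0 kerA y a hy Aa.
pose S := [set a | a \in A /\ forall y, hit y -> R y a = 0].
suff: [set` A] `<=` S by case/(_ a Aa) => _ /(_ y hy).
apply: minimal_invariant => [|c u v [Au Su] [Av Sv]|u []//|z u [Au Su]|].
- by split; [rewrite mem0v | move=> *; rewrite linear0].
- split=> [|z hz]; first by rewrite memvD ?memvZ.
  by rewrite linearP /= Su // Sv // scaler0 addr0.
- split=> [|w hw]; first exact: R_ideal.
  rewrite R_commutator Su // linear0 add0r big1 // => i _; apply: Su.
  exact: hit_tset.
have [u Su nz_u] := hit_common_kernel A0 kerA.
by exists u.
Qed.

End HitOperators.

(** * Regular derivations and splitting *)

Section Regular.

Variables (m : nat) (F : fieldType) (L : vectType F) (br : nLie m L).
Implicit Types (A B : {vspace L}) (d : 'End(L)).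

(** If [d] also preserves [A], these conditions make [A] and [ker d^2] the Fitting components of
    [d]. *)
Definition regular A d :=
  (forall a, a \in A -> d a = 0 -> a = 0) /\ (forall u, d (d u) \in A).

Lemma exists_regular A B b :
    minimal_abelian_embedded_ideal br A -> centraliser br A = [set` A] ->
    is_ideal br B -> bracket_rep br 2 [set` B] `<=` [set` A] ->
    b \in B -> b \notin A ->
  exists y, regular A (R br y).
Proof.
move=> [[idA A0 minA] abA] hC idB abB Bb nAb.
have [[y hy [a Aa nz_ya]]|no_hit2] := EM (exists2 y, hit2 B y &
    exists2 a, a \in A & R br y a != 0).
  exists y; split=> [c Ac yc|u]; last first.
    by case: hy => i [j [ij Bi Bj]]; apply: R_bracket2_hit ij Bi Bj.
  apply/eqP; apply: contraNT nz_ya => nz_c; apply/eqP.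
  (* Schur: the kernel of the central operator [R br y] in [A] is an ideal, so a nonzero [c] in it
     would force it to contain [a]. *)
  pose S := [set a | a \in A /\ R br y a = 0].
  suff: [set` A] `<=` S by case/(_ a Aa).
  apply: (minimal_invariant minA) => [|k u v [Au Su] [Av Sv]|u []//|z u [Au Su]|].
  - by split; [rewrite mem0v | rewrite linear0].
  - by split; [rewrite memvD ?memvZ | rewrite linearP /= Su Sv scaler0 addr0].
  - split; first exact: R_ideal.
    by rewrite (R_hit2_central abA abB) // Su linear0.
  by exists c.
have hit2A y a : hit2 B y -> a \in A -> R br y a = 0.
  move=> hy Aa; apply/eqP/contraT => nz_ya; case: no_hit2.
  by exists y => //; exists a.
have [[y hy inj_y]|no_reg] := EM (exists2 y, hit B y &
    forall a, a \in A -> R br y a = 0 -> a = 0).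
  exists y; split=> // u; have [i Bi] := hy; apply: (R_bracket2 abB Bi).
  exact: R_ideal_hit Bi.
have CA : centraliser br A `<=` [set` A] by rewrite hC.
case/negP: nAb; apply: CA => a x Aa.
(* Exchanging [b] and [a] turns the bracket, up to a scalar, into a hit applied to [a], with [b] as
   the entry in [B]. *)
have pE : perm_eq [tuple of b :: a :: x] [tuple of a :: b :: x].
  by have /permPl := perm_catCA [:: b] [:: a] x.
have [c ->] := bracket_perm_eq br pE; rewrite -RE.
rewrite (hit_centralises idA idB minA abA abB hit2A A0) ?scaler0 //.
  move=> y hy; apply: contrapT => no_a; case: no_reg; exists y => // u Au yu.
  by apply/eqP/contraT => nz_u; case: no_a; exists u.
by exists ord0; rewrite tnth0.
Qed.

(** The null component of a derivation is closed under the bracket by an iterated Leibniz rule;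
    bijectivity of [d] on [A] makes it a complement. *)
Lemma regular_split A y : is_ideal br A -> regular A (R br y) ->
  is_complement br A (lker (R br y \o R br y)).
Proof.
set d := R br y => idA [inj_d d2A].
have Ad u : u \in A -> d u \in A by apply: R_ideal.
(* Each derivation step lowers one [c i] by one, and an entry with [c i = 0] is already zero. The
   bound by the sum is crude but sufficient. *)
have iter_d_br s : forall (x : m.+2.-tuple L) (c : 'I_m.+2 -> nat),
    (forall i, iter (c i) d (tnth x i) = 0) -> (\sum_i c i <= s)%N ->
  iter s d (br x) = 0.
  have x0 (x : m.+2.-tuple L) i : tnth x i = 0 -> br x = 0.
    by move=> x0; rewrite -(tset_id x i) x0 bracket0.
  elim: s => [|s IHs] x c xc0 les.
    move: les; rewrite leqn0 sum_nat_eq0 => /forallP/(_ ord0)/= /eqP c0.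
    by apply: (x0 x ord0); rewrite -(xc0 ord0) c0.
  rewrite iterSr R_derivation; have [g gE] := iter_lfun d s.
  rewrite -gE linear_sum big1 // => i _ /=; rewrite gE.
  have [ci0|ci_gt0] := posnP (c i).
    rewrite (x0 _ i) ?tnth_tset ?eqxx; last first.
      by have := xc0 i; rewrite ci0 /= => ->; rewrite linear0.
    by rewrite -gE linear0.
  apply: (IHs _ (fun j => if j == i then (c i).-1 else c j)) => [j|].
    rewrite tnth_tset; case: eqP => // _.
    by rewrite -iterSr prednK.
  rewrite -ltnS (leq_trans _ les) // (bigD1 i) //= eqxx [leqRHS](bigD1 i) //=.
  rewrite -addSn prednK // leq_add2l leq_sum // => j /negPf-> //.
pose U := lker (d \o d).
have UE u : (u \in U) = (d (d u) == 0) by rewrite memv_ker comp_lfunE.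
split.
- apply: bracket_rep_sub => x Ux; rewrite -/U UE.
  have xc i : iter 2 d (tnth x i) = 0 by apply/eqP; rewrite -UE; apply: Ux.
  have := iter_d_br _ x (fun=> 2) xc (leqnn _).
  (* All values of [d^2] lie in [A], where [d] is injective, so surplus applications of [d] cancel
     down to two. *)
  have iterA k : iter k.+2 d (br x) = 0 -> d (d (br x)) = 0.
    by elim: k => // k IHk /(inj_d _ (d2A _)).
  by rewrite sum_nat_const card_ord muln2 doubleS => /iterA ->.
- have dA : (d @: (d @: A) = A)%VS.
    have dimd (W : {vspace L}) : (W <= A)%VS -> \dim (d @: W) = \dim W.
      move=> WA; apply: limg_dim_eq; apply/eqP; rewrite -subv0; apply/subvP => u.
      by rewrite memv_cap memv_ker memv0 => /andP[/(subvP WA)/inj_d du /eqP/du->].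
    have dAA : (d @: A <= A)%VS by apply/subvP => _ /memv_imgP[u /Ad Au ->].
    apply/eqP; rewrite eqEdim !dimd // leqnn andbT.
    exact: subv_trans (limgS _ dAA) dAA.
  apply/eqP; rewrite eqEsubv subvf; apply/subvP => u _.
  (* Some [a] in [A] has the same image as [u] under [d^2], so [u - a] lies in [U]. *)
  have := d2A u; rewrite -{1}dA => /memv_imgP[_ /memv_imgP[a Aa ->] ddu].
  rewrite -(subrK a u) memv_add // -/U UE !linearB /= ddu subrr //.
apply/eqP; rewrite -subv0; apply/subvP => u.
rewrite memv_cap -/U UE memv0 => /andP[/eqP ddu Au].
by rewrite (inj_d u) // (inj_d (d u)) // Ad.
Qed.

End Regular.

(** * Inner maps and conjugacy of complements *)

Section Conjugacy.

Variables (m : nat) (F : fieldType) (L : vectType F) (br : nLie m L).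
Variable A : {vspace L}.
Hypotheses (idA : is_ideal br A) (abA : abelian_embedded br A).
Implicit Types (y z : m.+1.-tuple L) (U V : {vspace L}) (d f g : 'End(L)).

Local Notation R := (R br).

(** A span, because sums of such right multiplications need not be of the same form and a dimension
    count is made on this space. *)
Definition inner_maps : set 'End(L) := span_set [set R z | z in [set z | hit A z]].

Lemma mem_inner_maps z : hit A z -> inner_maps (R z).
Proof.
move=> hz; exists [:: R z]; last by rewrite memv_span ?mem_head.
by move=> _ /[!inE]/eqP->; exists z.
Qed.

Lemma inner_maps_ind (P : 'End(L) -> Prop) :
    P 0 -> (forall a z f, hit A z -> P f -> P (a *: R z + f)) ->
  forall f, inner_maps f -> P f.
Proof.
move=> P0 PD f [s sR]; move: f; apply: span_ind => // a g f sg Pf.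
by have [z hz <-] := sR _ sg; apply: PD.
Qed.

Lemma inner_maps_vspace : exists I : {vspace 'End(L)}, inner_maps = [set` I].
Proof. exact: span_set_vspace. Qed.

Lemma inner_maps_linear a f g :
  inner_maps f -> inner_maps g -> inner_maps (a *: f + g).
Proof.
by have [I ->] := inner_maps_vspace => If Ig; rewrite /= memvD ?memvZ.
Qed.

Lemma inner_maps_ker f a : inner_maps f -> a \in A -> f a = 0.
Proof.
move=> If Aa; move: f If; apply: inner_maps_ind => [|c z f [i Az] fa].
  by rewrite zero_lfunE.
by rewrite add_lfunE scale_lfunE (R_abelian abA Az) // scaler0 fa addr0.
Qed.

Lemma inner_maps_img f u : inner_maps f -> f u \in A.
Proof.
move: f; apply: inner_maps_ind => [|c z f [i Az] fu].
  by rewrite zero_lfunE mem0v.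
by rewrite add_lfunE scale_lfunE memvD ?memvZ //; apply: R_ideal_hit Az.
Qed.

Lemma inner_maps_bracket y f : inner_maps f ->
  inner_maps ((R y \o f) - (f \o R y))%VF.
Proof.
have [I defI] := inner_maps_vspace.
move: f; apply: inner_maps_ind => [|a z f [i Az] If].
  by rewrite comp_lfun0l comp_lfun0r subr0 defI /= mem0v.
rewrite comp_lfunDr comp_lfunDl -comp_lfunZr -comp_lfunZl opprD addrACA -scalerBr.
apply: inner_maps_linear => {f If}//.
have -> : ((R y \o R z) - (R z \o R y))%VF = \sum_j R (tset z j (R y (tnth z j))).
  apply/lfunP=> u; rewrite sub_lfunE !comp_lfunE R_commutator sum_lfunE.
  by rewrite addrC addKr.
rewrite defI /= memv_suml // => j _.
suff: inner_maps (R (tset z j (R y (tnth z j)))) by rewrite defI.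
apply: mem_inner_maps; exists i; rewrite tnth_tset.
by case: eqP => // <-; apply: R_ideal.
Qed.

(** The entries of [y] are exchanged for those of [z] one at a time; each exchange adds a right
    multiplication with an entry in [A]. *)
Lemma inner_maps_sub y z : (forall i, tnth z i - tnth y i \in A) ->
  inner_maps (R z - R y).
Proof.
move=> zyA; have [I defI] := inner_maps_vspace.
pose w k := [tuple if (i < k)%N then tnth z i else tnth y i | i < m.+1].
have w0 : w 0%N = y by apply: eq_from_tnth => i; rewrite tnth_mktuple.
have wm : w m.+1 = z.
  by apply: eq_from_tnth => i; rewrite tnth_mktuple ltn_ord.
suff: forall k, (k <= m.+1)%N -> inner_maps (R (w k) - R y).
  by move/(_ _ (leqnn _)); rewrite wm.
elim=> [_|k IHk ltkm]; first by rewrite w0 subrr defI /= mem0v.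
pose i := Ordinal ltkm; pose t := tnth z i - tnth y i.
have -> : w k.+1 = tset (w k) i (1 *: t + tnth y i).
  apply: eq_from_tnth => j; rewrite tnth_tset !tnth_mktuple scale1r subrK.
  by rewrite ltnS leq_eqVlt -[k]/(val i) val_eqE; case: eqP => // ->.
have -> : tnth y i = tnth (w k) i by rewrite tnth_mktuple ltnn.
rewrite R_linear tset_id -addrA; apply: inner_maps_linear; last exact/IHk/ltnW.
by apply: mem_inner_maps; exists i; rewrite tnth_tset eqxx zyA.
Qed.

(** [R] takes its argument in the first place and [adD] in the last; [c] is the sign of the cyclic
    shift between them. *)
Lemma R_adD : exists c : F, forall z u, R z u = c *: adD br z u.
Proof.
pose s : 'S_m.+2 := perm (@ordS_inj m.+2).
exists ((-1) ^+ s) => z u.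
have -> : adD br z u = (-1) ^+ s *: R z u.
  rewrite /adD RE -bracket_perm; congr (br _); apply: eq_from_tnth => k.
  rewrite tnth_mktuple permE !(tnth_nth 0) /= nth_rcons size_tuple.
  have := ltn_ord k; rewrite ltnS leq_eqVlt => /predU1P[->|ltkm].
    by rewrite ltnn eqxx modnn.
  by rewrite ltkm modn_small.
by rewrite scalerA -signr_addb addbb scale1r.
Qed.

Lemma R_tperm z i j u : i != j ->
  R [tuple tnth z (tperm i j k) | k < m.+1] u = - R z u.
Proof.
move=> neq_ij; rewrite !RE -(@bracket_tperm _ _ _ br _ (lift ord0 i) (lift ord0 j)).
  congr (br _); apply: eq_from_tnth => k; rewrite tnth_mktuple.
  case: (unliftP ord0 k) => [l ->|->]; last by rewrite tpermD // !tnth0.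
  by rewrite -(inj_tperm _ _ _ lift_inj) !tnthS tnth_mktuple.
by rewrite (inj_eq lift_inj).
Qed.

(** A transposition brings the entry in [A] to the front, and the signs are absorbed into that
    entry. *)
Lemma R_hit_adD z : hit A z -> exists a (x : m.-tuple L), a \in A /\
  forall u, R z u = adD br [tuple of a :: x] u.
Proof.
case=> i Az.
have [c [a [x [Aa zE]]]] : exists c a (x : m.-tuple L), a \in A /\
    forall u, R z u = c *: R [tuple of a :: x] u.
  have [i0|nz_i] := eqVneq ord0 i.
    exists 1, (thead z), [tuple of behead z]; rewrite -tuple_eta /thead i0.
    by split=> // u; rewrite scale1r.
  pose z' := [tuple tnth z (tperm ord0 i k) | k < m.+1].
  exists (-1), (thead z'), [tuple of behead z'].
  rewrite -tuple_eta /thead tnth_mktuple tpermL; split=> // u.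
  by rewrite R_tperm // scaleN1r opprK.
have [c' RadD] := R_adD; exists ((c * c') *: a), x; split=> [|u]; first exact: memvZ.
rewrite zE RadD scalerA /adD.
pose t : m.+2.-tuple L := [tuple of a :: rcons x u].
have tE b : [tuple of rcons [tuple of b :: x] u] = tset t ord0 b.
  by rewrite tset_cons0; apply: val_inj.
by rewrite !tE bracketZ.
Qed.
(** Maps in [inner_maps] send [L] into [A] and kill [A], so [(1 + f)(1 + g) = 1 + f + g] and sums
    become compositions of generators. *)
Lemma inner_maps_automorphism f : inner_maps f ->
  inner_automorphism br A (fun u => u + f u).
Proof.
have gen z : hit A z -> inner_automorphism br A (fun u => u + R z u).
  move=> /R_hit_adD[a [x [Aa xE]]].
  have -> : (fun u => u + R z u) = (fun u => u + adD br [tuple of a :: x] u).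
    by apply/funext => u; rewrite xE.
  exact: InnerGen.
(* The induction also carries [inner_maps f], so that [f] kills the image of the next generator. *)
move=> If; have: inner_maps f /\ inner_automorphism br A (fun u => u + f u).
  move: f If; apply: inner_maps_ind => [|a z f hz [If inn_f]].
    split; first by have [I ->] := inner_maps_vspace; rewrite /= mem0v.
    pose z0 : m.+1.-tuple L := [tuple 0 | _ < m.+1].
    have hz0 : hit A z0 by exists ord0; rewrite tnth_mktuple mem0v.
    rewrite (_ : (fun u => u + _) = (fun u => u + R z0 u)); first exact: gen.
    apply/funext=> u; rewrite zero_lfunE RE -(tset_id [tuple of u :: z0] (lift ord0 ord0)).
    by rewrite tnthS tnth_mktuple bracket0.
  split; first by apply: inner_maps_linear => //; apply: mem_inner_maps.
  have [i Az] := hz.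
  have hz' : hit A (tset z i (a *: tnth z i)).
    by exists i; rewrite tnth_tset eqxx memvZ.
  have Rz' u : R (tset z i (a *: tnth z i)) u = a *: R z u.
    by rewrite !RE -tset_consS bracketZ tset_consS tset_id.
  rewrite (_ : (fun u => _) = (fun u => u + f u) \o
      (fun u => u + R (tset z i (a *: tnth z i)) u)).
    by apply: InnerComp => //; apply: gen.
  apply/funext=> u /=; rewrite Rz' linearD linearZ /= (inner_maps_ker If (a := R z u)).
    by rewrite scaler0 addr0 add_lfunE scale_lfunE addrA.
  exact: R_ideal_hit Az.
by case.
Qed.

(** The entries of [z] are the components in [U] of those of [y]. Then [R z] preserves [U], and its
    square maps [U] into the zero intersection of [U] and [A]. *)
Lemma regular_complement y U : regular A (R y) -> is_complement br A U ->
  exists z, [/\ inner_maps (R z - R y), regular A (R z) &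
    (forall u, u \in U -> R z u \in U) /\
    (forall u, (R z (R z u) == 0) = (u \in U))].
Proof.
move=> [inj_y y2A] [subU UA UIA].
have UA_split v : exists2 u, u \in U & v - u \in A.
  have : v \in (U + A)%VS by rewrite UA memvf.
  by case/memv_addP=> u Uu [a Aa ->]; exists u; rewrite // addrC addKr.
pose p v := s2val (cid2 (UA_split v)).
have pU v : p v \in U by rewrite /p; case: cid2.
have pA v : v - p v \in A by rewrite /p; case: cid2.
pose z := [tuple p (tnth y i) | i < m.+1].
have Iz : inner_maps (R z - R y).
  by apply: inner_maps_sub => i; rewrite tnth_mktuple -opprB memvN.
set e := R z - R y in Iz; have RzE u : R z u = R y u + e u.
  by rewrite sub_lfunE addrC subrK.
have RyA a : a \in A -> R y a \in A by apply: R_ideal.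
have eA u : e u \in A by apply: inner_maps_img.
have RzU u : u \in U -> R z u \in U.
  move=> Uu; rewrite RE; apply: subU; apply: mem_bracket_rep => i _ /=.
  by case: (unliftP ord0 i) => [j ->|->]; rewrite ?tnthS ?tnth_mktuple ?tnth0.
have inj_z a : a \in A -> R z a = 0 -> a = 0.
  by move=> Aa; rewrite RzE (inner_maps_ker Iz) // addr0; apply: inj_y.
have z2A u : R z (R z u) \in A.
  have zeA : R z (e u) \in A by apply: R_ideal.
  by rewrite (RzE u) linearD /= memvD // RzE memvD.
have UIA0 u : u \in U -> u \in A -> u = 0.
  by move=> Uu Au; apply/eqP; rewrite -memv0 -UIA memv_cap Uu.
exists z; split=> //; split=> // u; apply/eqP/idP => [zu|Uu]; last first.
  by apply: UIA0 => //; rewrite !RzU.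
(* The square of [R z] kills both [u] and its component [v] in [U], and is injective on [A], which
   contains [u - v]. *)
have [v Uv Auv] := UA_split u; suff /eqP : u - v = 0 by rewrite subr_eq0 => /eqP->.
apply: (inj_z) => //; apply: inj_z; first exact: R_ideal.
by rewrite !linearB /= zu (UIA0 (R z (R z v))) ?subr0 // ?RzU.
Qed.

(** If [g] commutes with [R y], then [(R y)^2 g = g (R y)^2 = 0], because [g] kills [A]; hence
    [g = 0]. An injective endomorphism of a finite-dimensional space is surjective. *)
Lemma regular_bracket_surj y f : regular A (R y) -> inner_maps f ->
  exists2 g, inner_maps g & forall u, R y (g u) - g (R y u) = f u.
Proof.
move=> [inj_y y2A]; have [I defI] := inner_maps_vspace.
pose ad g : 'End(L) := ((R y \o g) - (g \o R y))%VF.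
have ad_lin : linear ad.
  move=> a g h; rewrite /ad comp_lfunDr comp_lfunDl -comp_lfunZr -comp_lfunZl.
  by rewrite opprD addrACA -scalerBr.
pose adL := GRing.isLinear.Build F 'End(L) 'End(L) _ ad ad_lin.
pose adf : {linear 'End(L) -> 'End(L)} := HB.pack ad adL.
pose D := linfun adf.
have DE g : D g = ad g by rewrite lfunE.
have DI : (D @: I <= I)%VS.
  apply/subvP=> _ /memv_imgP[g Ig ->]; rewrite DE.
  by have := @inner_maps_bracket y g; rewrite defI; apply.
have kerD : (I :&: lker D = 0)%VS.
  apply/eqP; rewrite -subv0; apply/subvP => g; rewrite memv_cap memv_ker memv0 DE.
  case/andP=> Ig /eqP/lfunP adg.
  have {}Ig : inner_maps g by rewrite defI.
  have comm u : R y (g u) = g (R y u).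
    apply/eqP; rewrite -subr_eq0; have := adg u.
    by rewrite sub_lfunE !comp_lfunE zero_lfunE => ->.
  apply/eqP/lfunP=> u; rewrite zero_lfunE; have gA v := inner_maps_img v Ig.
  apply: (inj_y) => //; apply: inj_y; first exact: R_ideal.
  by rewrite !comm (inner_maps_ker Ig).
have /eqP DI_I : (D @: I == I)%VS by rewrite eqEdim DI limg_dim_eq ?leqnn.
rewrite {1}defI /= -DI_I => /memv_imgP[g Ig ->]; exists g; first by rewrite defI.
by move=> u; rewrite DE sub_lfunE !comp_lfunE.
Qed.

Lemma regular_conjugate y U V : regular A (R y) ->
  is_complement br A U -> is_complement br A V -> conjugate br A U V.
Proof.
move=> reg cU cV.
have [zU [IU regU [stabU kerU]]] := regular_complement reg cU.
have [zV [IV regV [stabV kerV]]] := regular_complement reg cV.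
have Ie : inner_maps (R zU - R zV).
  have := inner_maps_linear (-1) IV IU; rewrite scaleN1r opprB.
  by rewrite addrC addrA subrK.
have [f If fE] := regular_bracket_surj regU Ie.
(* [R zV] and [R zU] agree on [f u], which lies in [A]; on [u] their difference is cancelled by the
   commutator [fE]. *)
have intertwine u : R zV (u + f u) = R zU u + f (R zU u).
  have fu0 := inner_maps_ker Ie (inner_maps_img u If).
  rewrite linearD /=; have := fE u; rewrite !sub_lfunE in fu0 *.
  move/subr0_eq: fu0 => -> /eqP; rewrite subr_eq => /eqP->.
  by rewrite addrA addrCA subrr addr0 addrC.
have fUV u : u \in U -> u + f u \in V.
  move=> Uu; rewrite -kerV !intertwine.
  by rewrite (eqP (_ : R zU (R zU u) == 0)) ?kerU // linear0 addr0.
exists (fun u => u + f u); first exact: inner_maps_automorphism.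
case: cU cV => _ UA _ [_ _ VA].
apply/seteqP; split=> [_ [u /= Uu <-]|v /= Vv]; first exact: fUV.
have : v \in (U + A)%VS by rewrite UA memvf.
case/memv_addP=> u Uu [a Aa def_v]; exists u => //=.
(* The difference of [v] and [u + f u] is [a - f u] up to sign, which lies in both [V] and [A]. *)
apply/eqP; rewrite eq_sym -subr_eq0 -memv0 -VA memv_cap memvB ?fUV //=.
by rewrite def_v opprD addrACA subrr add0r memvB // inner_maps_img.
Qed.

End Conjugacy.

(** * The case [A = L] and the theorem *)

Lemma split_full (m : nat) (F : fieldType) (L : vectType F) (br : nLie m L) :
  is_complement br fullv 0%VS.
Proof.
split; [|by rewrite add0v|by rewrite cap0v].
apply: bracket_rep_sub => x /(_ ord0 isT) /= /[!memv0]/eqP x0.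
by rewrite -(tset_id x ord0) x0 bracket0.
Qed.

Lemma conjugate_full (m : nat) (F : fieldType) (L : vectType F) (br : nLie m L)
    (U V : {vspace L}) :
  is_complement br fullv U -> is_complement br fullv V -> conjugate br fullv U V.
Proof.
have comp0 W : is_complement br fullv W -> W = 0%VS by case=> _ _; rewrite capvf.
move=> /comp0-> /comp0->.
exists (fun u => u + adD br [tuple of 0 :: [tuple 0 | _ < m]] u).
  by apply: InnerGen; rewrite mem0v.
have E u : u + adD br [tuple of 0 :: [tuple 0 | _ < m]] u = u.
  pose t : m.+2.-tuple L := [tuple of 0 :: rcons [tuple 0 | _ < m] u].
  rewrite /adD (_ : [tuple of _] = tset t ord0 0) ?bracket0 ?addr0 //.
  by rewrite tset_cons0; apply: val_inj.
by apply/seteqP; split=> [_ [u u0 <-]|u u0]; [rewrite E | exists u].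
Qed.

Theorem theorem3p9 (m : nat) (F : fieldType) (L : vectType F) (br : nLie m L)
    (A : {vspace L})
    (hsol : soluble2 br)
    (hA : minimal_abelian_embedded_ideal br A)
    (hC : centraliser br A = [set` A]) :
  (exists U : {vspace L}, is_complement br A U) /\
  (forall U V : {vspace L}, is_complement br A U -> is_complement br A V ->
     conjugate br A U V).
Proof.
have [[idA _ _] abA] := hA.
have exs : exists s, `[< derived2 br s `<=` [set` A] >].
  have [r r0] := hsol; exists r; apply/asboolP; rewrite r0 => _ ->.
  by rewrite /= mem0v.
(* Least index zero means [A = L]; otherwise [B] is the term just before the first one contained in
   [A]. *)
case: (ex_minnP exs) => -[|s] /asboolP dsA mins.
  have -> : A = fullv.
    by apply/eqP; rewrite eqEsubv subvf; apply/subvP=> u _; apply: dsA.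
  by split=> [|U V]; [exists 0%VS; apply: split_full | apply: conjugate_full].
have [B defB idB] := derived2_ideal br s; rewrite /= defB in dsA.
have [b Bb nAb] : exists2 b, b \in B & b \notin A.
  apply: contrapT => BA; have /mins : `[< derived2 br s `<=` [set` A] >].
    apply/asboolP; rewrite defB => u Bu; apply/negPn/negP => nAu.
    by case: BA; exists u.
  by rewrite ltnn.
have [y reg] := exists_regular hA hC idB dsA Bb nAb.
split=> [|U V]; last exact: regular_conjugate reg.
by eexists; apply: regular_split reg.
Qed.
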